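(* Let $P,R\in C^2(\mathbb{R})$ be $2\pi$-periodic with $\sup_{x\in\mathbb{R}}P(x)R(x)>0$, put $\kappa_*:=\big(\sup_{x\in\mathbb{R}}P(x)R(x)\big)^{-1}$, and assume that $$\int_0^{2\pi}\frac{P(s)R'(s)}{1-\kappa P(s)R(s)}\,ds>0\qquad\text{for all }\kappa\in(0,\kappa_* ).$$ Let $U$ be the open set of parameters $(\gamma,\kappa)$ and $C^n_{\gamma,\kappa}\subset\mathbb{R}^n$ the associated sets described in the context. Then for every $(\gamma,\kappa)\in U$, every $n\ge 1$ and every choice of natural frequencies $\omega_1,\dots,\omega_n\in(1-\gamma,1+\gamma)$, the Winfree model $$\dot x_i=\omega_i-\kappa\,\sigma(x)R(x_i),\quad 1\le i\le n,\qquad \sigma(x):=\frac1n\sum_{j=1}^nP(x_j),$$ with flow $\Phi^t$, is $\Phi^t$-positively stable on $C^n_{\gamma,\kappa}$; that is, $\Phi^t(C^n_{\gamma,\kappa})\subset C^n_{\gamma,\kappa}$ for all $t\ge0$, and there exists $\lambda>0$ such that for every $x\in C^n_{\gamma,\kappa}$ there exists $\delta>0$ such that for every $y\in C^n_{\gamma,\kappa}$ with $\|x-y\|<\delta$, $$\|\Phi^t(x)-\Phi^t(y)\|\le\lambda\|x-y\|\qquad\text{for all }t\ge0.$$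
   Context: Let $M:=16\max\{\|P^{(i)}\|_\infty\|R^{(j)}\|_\infty: 0\le i,j\le2\}$. The set $U$ and the sets $C^n_{\gamma,\kappa}$ (their existence under the integral hypothesis is a previously known result and is taken as given): $U$ is an open set $$U\subset\Big\{(\gamma,\kappa)\in(0,1)\times(0,\kappa_* ):\ 1-\gamma-\frac{\kappa}{\kappa_*}>0\Big\}$$ whose closure contains $\{0\}\times[0,\kappa_*]$, such that for every $n\ge1$ and every $(\gamma,\kappa)\in U$ there exist: (i) a constant $D\in(0,1)$ with $1-\gamma-M\kappa D-\kappa/\kappa_*>0$, and the associated constant $$\alpha(\gamma,\kappa,D):=\frac{2\gamma+M\kappa D^2}{1-\kappa/\kappa_*}+\frac{(2\gamma+M\kappa D^2+M\kappa D)(\gamma+M\kappa D)}{(1-\gamma-M\kappa D-\kappa/\kappa_* )(1-\kappa/\kappa_* )};$$ (ii) a $C^2$ $2\pi$-periodic function $\Delta_{\gamma,\kappa}:\mathbb{R}\to(0,D)$ solving $$\frac{d}{ds}\Delta_{\gamma,\kappa}(s)=-\frac{\kappa P(s)R'(s)}{1-\kappa P(s)R(s)}\Delta_{\gamma,\kappa}(s)+\alpha(\gamma,\kappa,D);$$ (iii) such that the open set $$C^n_{\gamma,\kappa}:=\Big\{x=(x_i)_{i=1}^n\in\mathbb{R}^n:\ \max_{i,j}|x_j-x_i|<\Delta_{\gamma,\kappa}\Big(\frac1n\sum_{i=1}^nx_i\Big)\Big\}$$ is positively invariant under the flow $\Phi^t$ of the Winfree model (i.e. $\Phi^t(C^n_{\gamma,\kappa})\subset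 C^n_{\gamma,\kappa}$ for all $t\ge0$) for every choice of natural frequencies $\omega_i\in(1-\gamma,1+\gamma)$. For each $(\gamma,\kappa)\in U$ such $D$, $\Delta_{\gamma,\kappa}$ and $C^n_{\gamma,\kappa}$ are fixed. *)

(* Defs.v *)
(* The real line is an arbitrary [K : realType], the letter R being the phase
   response function. *)
From HB Require Import structures.
From mathcomp Require Export all_boot all_order all_algebra.
From mathcomp Require Export all_classical all_reals all_analysis.

Set Implicit Arguments.
Unset Strict Implicit.
Unset Printing Implicit Defensive.

Import Order.TTheory GRing.Theory Num.Theory.
Import numFieldNormedType.Exports.

Local Open Scope ring_scope.
Local Open Scope classical_set_scope.

(* The derivability conjuncts are needed because [f^`()] is a total operator,
   with an arbitrary value where f is not derivable. *)
Definition C2 (K : realType) (f : K -> K) : Prop :=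
  [/\ forall x : K, derivable f x 1,
      forall x : K, derivable f^`() x 1
    & continuous f^`(2)].

Definition sup_norm (K : realType) (f : K -> K) : K :=
  sup (range (fun x => `|f x|)).

Definition kappa_star (K : realType) (P R : K -> K) : K :=
  (sup (range (fun x => P x * R x)))^-1.

(* All the terms are nonnegative, so the default value 0 of the iterated
   maximum plays no role. *)
Definition Mconst (K : realType) (P R : K -> K) : K :=
  16 * \big[Num.max/0]_(i < 3) \big[Num.max/0]_(j < 3)
         (sup_norm P^`(i) * sup_norm R^`(j)).

Definition alpha (K : realType) (P R : K -> K) (gamma kappa D : K) : K :=
  let M := Mconst P R in
  let ks := kappa_star P R in
  (2 * gamma + M * kappa * D ^+ 2) / (1 - kappa / ks)
  + ((2 * gamma + M * kappa * D ^+ 2 + M * kappa * D)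
       * (gamma + M * kappa * D))
    / ((1 - gamma - M * kappa * D - kappa / ks) * (1 - kappa / ks)).

Definition sigma (K : realType) (P : K -> K) (n : nat) (x : 'rV[K]_n) : K :=
  n%:R^-1 * \sum_(j < n) P (x 0 j).

Definition winfree (K : realType) (P R : K -> K) (kappa : K) (n : nat)
    (omega : 'I_n -> K) (x : 'rV[K]_n) : 'rV[K]_n :=
  \row_(i < n) (omega i - kappa * sigma P x * R (x 0 i)).

(* [Phi t x] is the value at time t of the solution issued from x at time 0.
   For a locally Lipschitz [F], such as [winfree] with P and R of class C^2,
   there is at most one such Phi, and the group law follows from uniqueness. *)
Definition is_flow (K : realType) (n : nat) (F : 'rV[K]_n -> 'rV[K]_n)
    (Phi : K -> 'rV[K]_n -> 'rV[K]_n) : Prop :=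
  forall x, Phi 0 x = x /\
    forall t : K, is_derive t 1 (fun s : K => Phi s x) (F (Phi t x)).

Definition positively_invariant (K : realType) (n : nat)
    (Phi : K -> 'rV[K]_n -> 'rV[K]_n) (C : set 'rV[K]_n) : Prop :=
  forall t : K, 0 <= t -> Phi t @` C `<=` C.

(* The norm of ['rV[K]_n] is the maximum norm; lambda does not depend on x
   whereas delta may, so the choice of the norm on R^n is immaterial. *)
Definition positively_stable (K : realType) (n : nat)
    (Phi : K -> 'rV[K]_n -> 'rV[K]_n) (C : set 'rV[K]_n) : Prop :=
  positively_invariant Phi C /\
  exists2 lambda : K, 0 < lambda &
    forall x, C x -> exists2 delta : K, 0 < delta &
      forall y, C y -> `|x - y| < delta ->
        forall t : K, 0 <= t -> `|Phi t x - Phi t y| <= lambda * `|x - y|.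

Definition mean (K : realType) (n : nat) (x : 'rV[K]_n) : K :=
  n%:R^-1 * \sum_(i < n) x 0 i.

Definition sync_set (K : realType) (n : nat) (Delta : K -> K) :
    set 'rV[K]_n :=
  [set x : 'rV[K]_n | \big[Num.max/0]_(i < n) \big[Num.max/0]_(j < n) `|x 0 j - x 0 i|
           < Delta (mean x)].
Arguments sync_set {K} n Delta _.

Definition sync_data (K : realType) (P R : K -> K) (gamma kappa : K) (n : nat)
    (D : K) (Delta : K -> K) : Prop :=
  [/\ 0 < D < 1 /\
      0 < 1 - gamma - Mconst P R * kappa * D - kappa / kappa_star P R,
      [/\ C2 Delta, periodic Delta (2 * pi), forall s : K, 0 < Delta s < D
        & forall s : K, derive1 Delta s =
            - (kappa * P s * derive1 R s / (1 - kappa * P s * R s)) * Delta s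
            + alpha P R gamma kappa D]
    & forall (omega : 'I_n -> K) (Phi : K -> 'rV[K]_n -> 'rV[K]_n),
        (forall i, 1 - gamma < omega i < 1 + gamma) ->
        is_flow (winfree P R kappa omega) Phi ->
        positively_invariant Phi (sync_set n Delta)].

Definition sync_region (K : realType) (P R : K -> K) (U : set (K * K)) : Prop :=
  let ks := kappa_star P R in
  [/\ open U,
      forall gamma kappa : K, U (gamma, kappa) ->
        [/\ 0 < gamma < 1, 0 < kappa < ks & 0 < 1 - gamma - kappa / ks]
    & forall kappa : K, 0 <= kappa <= ks -> closure U (0, kappa)].

(* Main.v *)
(** Let x and y be two solutions staying in the invariant set. Each coordinate
    of x is strictly increasing in time, so y_i(t) = x_i(tau_i(t)) defines phases
    tau_i, and
      tau_i' - 1 = - kappa R(y_i) (sigma(y(t)) - sigma(x(tau_i))) / v_i(x(tau_i))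
    involves only the differences tau_j - tau_k. Put g = 1 - kappa P R, and let m
    be the mean of y. Up to errors controlled by gamma and M kappa D, the width
    tau_i - tau_k of the phases grows at the rate kappa P' R (m) along the flow,
    whereas m moves at speed g(m). Since Delta' = - kappa P R' / g Delta + alpha,
    the function h = g / Delta satisfies h' / h = - kappa P' R / g - alpha / Delta,
    so that the factor h(m) cancels this rate and leaves the margin
    alpha / Delta > alpha / D. Rolle's theorem for the periodic function Delta
    gives alpha <= kappa M D / (16 (1 - kappa / kappa_star)), hence
    16 (gamma + M kappa D) <= 1 - gamma - M kappa D - kappa / kappa_star, and the
    margin beats the errors.
    Thus (tau_i - tau_k) h(m), when maximal over i and k, decreases fast enough
    for |tau_l - t| + C (tau_i - tau_k) h(m), maximized over i, k and l, to be
    nonincreasing. This bounds |tau_l(t) - t|, hence |y_l(t) - x_l(t)|, by a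
    multiple of |x(0) - y(0)|. *)

Require Import Defs.
From mathcomp Require Import all_boot all_order all_algebra.
From mathcomp Require Import all_classical all_reals all_analysis.
From mathcomp Require Import ring lra.

Set Implicit Arguments.
Unset Strict Implicit.
Unset Printing Implicit Defensive.

Import Order.TTheory GRing.Theory Num.Theory.
Import numFieldNormedType.Exports.

Local Open Scope ring_scope.
Local Open Scope classical_set_scope.

(** * Calculus *)

Lemma is_derive_MVT (K : realType) (f df : K -> K) (a b : K) : a <= b ->
  (forall x : K, a <= x <= b -> is_derive x 1 f (df x)) ->
  exists2 c, a <= c <= b & f b - f a = df c * (b - a).
Proof.
move=> ab fdf.
have [||c] := @MVT_segment K f df a b ab.
- by move=> x; rewrite in_itv/= => /andP[/ltW ax /ltW xb]; apply: fdf; rewrite ax.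
- apply: derivable_within_continuous => x; rewrite in_itv/= => axb.
  by have [] := fdf x axb.
by rewrite in_itv/=; exists c.
Qed.

Lemma lipschitz_of_deriv_le (K : realType) (f df : K -> K) (c a b : K) :
  (forall x : K, is_derive x 1 f (df x)) -> (forall x, `|df x| <= c) ->
  `|f a - f b| <= c * `|a - b|.
Proof.
move=> fdf dfc; wlog ab : a b / b <= a.
  move=> H; have [/H//|/ltW/H] := leP b a.
  by rewrite distrC [in X in _ <= X]distrC.
have [z _ ->] := is_derive_MVT ab (fun x _ => fdf x).
by rewrite normrM ler_wpM2r.
Qed.

Lemma increment_ge (K : realType) (f df : K -> K) (c a b : K) : a <= b ->
  (forall x : K, a <= x <= b -> is_derive x 1 f (df x)) ->
  (forall x : K, a <= x <= b -> c <= df x) -> c * (b - a) <= f b - f a.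
Proof.
move=> ab fdf cdf; have [z zab ->] := is_derive_MVT ab fdf.
by rewrite ler_wpM2r ?subr_ge0// cdf.
Qed.

Lemma periodic_reduce (K : realType) (f : K -> K) (T x : K) : 0 < T ->
  periodic f T -> exists2 y, 0 <= y <= T & f x = f y.
Proof.
move=> T0 fT.
have fTz (z : int) u : f (u + T *~ z) = f u.
  case: z => m; first exact: periodicn.
  by rewrite NegzE mulrNz -(periodicn fT m.+1 (u - T *~ m.+1)) subrK.
have Te : x / T * T = x by rewrite divfK// gt_eqF.
exists (x - T *~ Num.floor (x / T)).
  have /andP[l1 l2] := floor_itv (x / T).
  move: l1 l2; set k := Num.floor _ => l1 l2.
  rewrite -mulrzr [T * _]mulrC -Te -mulrBl; apply/andP; split.
    by rewrite mulr_ge0 ?subr_ge0// ltW.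
  rewrite -[leRHS]mul1r ler_wpM2r ?ltW//.
  by move: l2; rewrite intrD; lra.
by rewrite -(fTz (- Num.floor (x / T))) mulrNz.
Qed.

Lemma periodic_min (K : realType) (f : K -> K) (T : K) : 0 < T ->
  continuous f -> periodic f T -> exists c, forall x, f c <= f x.
Proof.
move=> T0 cf fT.
have [|c _ fc] := @EVT_min K f 0 T (ltW T0); first exact: continuous_subspaceT.
exists c => x; have [y y0 ->] := periodic_reduce x T0 fT.
by apply: fc; rewrite in_itv.
Qed.

(** [sup] dominates the values only when they are bounded above; the bound is a maximum of |f|,
    found as a minimum of -|f|. *)
Lemma periodic_sup_norm (K : realType) (f : K -> K) (T : K) : 0 < T ->
  continuous f -> periodic f T -> forall x, `|f x| <= sup_norm f.
Proof.
move=> T0 cf fT x.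
have [||c cmin] := @periodic_min K (fun x => - `|f x|) T T0.
- move=> z; apply: (@cvgN K K^o); apply: cvg_norm; exact: cf.
- by move=> u; rewrite /= fT.
apply: ub_le_sup; last by exists x.
by exists `|f c| => _ [z _ <-]; rewrite -lerN2.
Qed.

Lemma periodic_derive1 (K : realType) (f : K -> K) (T : K) :
  (forall x : K, derivable f x 1) -> periodic f T -> periodic (derive1 f) T.
Proof.
move=> df fT u.
have E : f = f \o (fun x => x + T) by apply/funext => x /=; rewrite fT.
have D : is_derive u 1 f (derive1 f (u + T) * 1).
  rewrite [in X in is_derive _ _ X]E.
  apply: is_derive1_comp; first by rewrite derive1E; exact/derivableP/df.
  by apply: is_derive_eq; rewrite ?addr0.
by rewrite [RHS]derive1E (@derive_val _ _ _ _ _ _ _ D) mulr1.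
Qed.

(** Left difference quotients at [c] are nonnegative. Only times before [c] are compared, since a
    maximum over a time interval may sit at its right end. *)
Lemma derive_ge0_at_left_max (K : realType) (f : K -> K) (a c df : K) : a < c ->
  is_derive c 1 f df -> (forall t : K, a <= t <= c -> f t <= f c) -> 0 <= df.
Proof.
move=> ac fdf fm; have [fd <-] := fdf.
rewrite ['D_1 f c]cvg_at_leftE; last exact: fd.
apply: limr_ge.
  have dfc := fd.
  rewrite -(cvg_at_leftE (fun h => h^-1 *: ((f \o shift c) _ - f c))) //.
  apply: cvg_trans dfc; apply: cvg_app.
  move=> A [e egt0 Ae]; exists e => // x xe xgt0; apply: Ae => //.
  exact/ltr0_neq0.
near=> h; apply: mulr_le0.
  by rewrite invr_le0; apply: ltW; near: h; exists 1 => /=.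
rewrite subr_le0 [_%:A]mulr1; apply: fm; near: h.
exists (c - a); first by rewrite /= subr_gt0.
move=> h; rewrite /= distrC subr0 => /ltr_normlP [h1 h2] h0.
by apply/andP; split; lra.
Unshelve. all: by end_near. Qed.

Lemma max_principle (K : realType) (I : finType) (f df : I -> K -> K) (B : K) :
  (forall i (t : K), 0 <= t -> is_derive t 1 (f i) (df i t)) ->
  (forall i (t : K), 0 < t -> (forall j, f j t <= f i t) -> df i t <= 0) ->
  (forall i, f i 0 <= B) ->
  forall i (t : K), 0 <= t -> f i t <= B.
Proof.
(* Subtracting [eta * t] makes a violation at t1 force a maximum over I x [0, t1]
   at a positive time, where the derivative is at most [- eta]. *)
move=> fdf dneg f0 i t1 t10; rewrite leNgt; apply/negP => Bf.
have t1p : 0 < t1.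
  by rewrite lt_neqAle t10 andbT; apply: contraTneq Bf => <-; rewrite -leNgt.
(* With this slope [g i t1] is the midpoint of [B] and [f i t1], hence still above [B]. *)
pose eta := (f i t1 - B) / (2 * t1).
have eta0 : 0 < eta by rewrite divr_gt0 ?mulr_gt0 ?subr_gt0.
pose g j t := f j t - eta * t.
have gdf j (t : K) : 0 <= t -> is_derive t 1 (g j) (df j t - eta).
  move=> t0; have ? := fdf j t t0.
  have -> : g j = f j - (eta *: (id : K -> K)) by apply/funext.
  by apply: is_derive_eq; rewrite [_ *: _]mulr1.
have gi : B < g i t1.
  by rewrite /g /eta invfM -!mulrA mulVf ?gt_eqF// mulr1; lra.
have /choice[c cP] : forall j, exists c,
    0 <= c <= t1 /\ forall t : K, 0 <= t <= t1 -> g j t <= g j c.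
  move=> j; have [|c c01 cm] := @EVT_max K (g j) 0 t1 t10.
    apply: derivable_within_continuous => x; rewrite in_itv/= => /andP[x0 _].
    by have [] := gdf j x x0.
  by exists c; split => // t t01; apply: cm; rewrite in_itv.
have [j _ jm] := @arg_maxP _ _ _ i xpredT (fun j => g j (c j)) isT.
have [/andP[c0 c1] cm] := cP j.
have gc : B < g j (c j).
  apply: (lt_le_trans gi); apply: le_trans (jm i isT).
  by apply: (cP i).2; rewrite t10 lexx.
have cp : 0 < c j.
  rewrite lt_neqAle c0 andbT; apply: contraTneq gc => <-.
  by rewrite -leNgt /g mulr0 subr0.
have jmax k : f k (c j) <= f j (c j).
  suff : g k (c j) <= g j (c j) by rewrite /g lerD2r.
  by apply: le_trans (jm k isT); apply: (cP k).2; rewrite c0.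
have := dneg j (c j) cp jmax.
have : 0 <= df j (c j) - eta.
  apply: (derive_ge0_at_left_max cp (gdf j (c j) c0)) => t /andP[ta tb].
  by apply: cm; rewrite ta (le_trans tb).
lra.
Qed.

(** * Phases *)

(** [sigma] and [mean] unfold to such averages. Families on ['I_n] are convenient because the
    coordinates of x are read at different times [tau i]. *)
Definition avg (K : realType) (n : nat) (u : 'I_n -> K) : K :=
  n%:R^-1 * \sum_(i < n) u i.

Section Average.
Context (K : realType) (n : nat).
Hypothesis n_gt0 : (0 < n)%N.
Implicit Types (u w : 'I_n -> K) (b c : K).

Lemma avgB u w : avg u - avg w = avg (fun i => u i - w i).
Proof. by rewrite /avg -mulrBr sumrB. Qed.

Lemma avgZ c u : c * avg u = avg (fun i => c * u i).
Proof. by rewrite /avg mulrCA mulr_sumr. Qed.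

Lemma avg_cst c : avg (fun _ : 'I_n => c) = c.
Proof.
rewrite /avg sumr_const card_ord -[c *+ n]mulr_natl mulrA mulVf ?mul1r//.
by rewrite pnatr_eq0 -lt0n.
Qed.

Lemma norm_avg_le u b : (forall i, `|u i| <= b) -> `|avg u| <= b.
Proof.
move=> ub; rewrite -[leRHS]avg_cst /avg normrM ger0_norm ?invr_ge0//.
rewrite ler_wpM2l ?invr_ge0// (le_trans (ler_norm_sum _ _ _))//.
exact: ler_sum.
Qed.

Lemma avg_dist_le u c b : (forall i, `|u i - c| <= b) -> `|avg u - c| <= b.
Proof. by move=> ub; rewrite -[c]avg_cst avgB; exact: norm_avg_le. Qed.

Lemma is_derive_avg (f : 'I_n -> K -> K) (df : 'I_n -> K) (t : K) :
  (forall i, is_derive t 1 (f i) (df i)) ->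
  is_derive t 1 (fun s => avg (fun i => f i s)) (avg df).
Proof.
move=> fdf.
have -> : (fun s => avg (fun i => f i s)) = n%:R^-1 *: (\sum_(i < n) f i).
  by apply/funext => s; rewrite /avg /= fctE/= fct_sumE.
by apply: is_derive_eq; rewrite /avg.
Qed.
End Average.

(* [Z = kappa P' R] at the mean, and [e] bounds the error made when a velocity
   is replaced by [g]; the terms on the left are those of [phase_contraction]. *)
Lemma contraction_rate (K : realType) (N D Z g e a vi vk w : K) :
  0 < N -> 0 < D -> 0 < g -> 0 <= e -> 17 * e <= g -> `|Z| <= N ->
  `|vi - g| <= e -> `|vk - g| <= e -> `|w - g| <= e ->
  16 * N * D + 16 * N * (e / g) <= a * g ->
  (Z * g + 4 * N * D * (g + e) + N * e) / vi
  + 2 * N * e * (g + e) / (vi * vk) - (Z / g + a) * w <= - (N * D).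
Proof.
move=> N0 D0 g0 e0 eg; rewrite !ler_norml.
move=> /andP[Z1 Z2] /andP[i1 i2] /andP[k1 k2] /andP[w1 w2] ag.
have a0 : 0 <= a.
  rewrite -(pmulr_lge0 _ g0) (le_trans _ ag)// addr_ge0// !mulr_ge0 ?invr_ge0//; lra.
have vi0 : 0 < vi by lra.
have vk0 : 0 < vk by lra.
pose theta := e / g.
have eE : e = theta * g by rewrite /theta divfK// gt_eqF.
have th0 : 0 <= theta by rewrite divr_ge0// ltW.
have NDp : 0 < N * D by rewrite mulr_gt0.
have Nt0 : 0 <= N * theta by rewrite mulr_ge0// ltW.
(* From 17 e <= g every velocity is at least 16 g / 17, whence the factors 17/16 and 18/16. *)
have T1 : e / vi <= 17 / 16 * theta.
  rewrite ler_pdivrMr// eE.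
  have -> : 17 / 16 * theta * vi = theta * (17 / 16 * vi) by ring.
  by rewrite ler_wpM2l//; lra.
have T2 : (g + e) / vi <= 18 / 16 by rewrite ler_pdivrMr//; lra.
have T1k : e / vk <= 17 / 16 * theta.
  rewrite ler_pdivrMr// eE.
  have -> : 17 / 16 * theta * vk = theta * (17 / 16 * vk) by ring.
  by rewrite ler_wpM2l//; lra.
(* [U1] and [U3] leave the terms Z and -Z, which cancel in the sum; the margin [U4] then outweighs
   the remaining errors. *)
have U1 : Z * g / vi <= Z + N * (e / vi).
  have -> : Z * g / vi = Z + Z * (g - vi) / vi.
    by field; rewrite gt_eqF.
  rewrite lerD2l mulrA ler_wpM2r ?invr_ge0 ?(ltW vi0)//.
  rewrite (le_trans (ler_norm _))// normrM ler_pM// ler_norml; lra.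
have U2 : 2 * N * e * (g + e) / (vi * vk) <= 2 * N * (17 / 16 * theta * (18 / 16)).
  have -> : 2 * N * e * (g + e) / (vi * vk) = 2 * N * (e / vk * ((g + e) / vi)).
    by field; rewrite !gt_eqF.
  rewrite ler_wpM2l ?mulr_ge0 ?(ltW N0)// ler_pM// divr_ge0 ?addr_ge0 ?(ltW vi0) ?(ltW vk0) ?(ltW g0)//.
have U3 : - (Z / g * w) <= - Z + N * theta.
  have -> : Z / g * w = Z + Z * (w - g) / g by field; rewrite gt_eqF.
  suff : - (Z * (w - g) / g) <= N * theta by lra.
  rewrite (le_trans (ler_norm _))// normrN /theta mulrA normrM.
  rewrite [X in _ * X]ger0_norm ?invr_ge0 ?(ltW g0)//.
  rewrite ler_wpM2r ?invr_ge0 ?(ltW g0)// normrM ler_pM// ler_norml; lra.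
have U4 : 16 / 17 * (16 * N * D + 16 * N * theta) <= a * w.
  apply: (@le_trans _ _ (a * (16 / 17 * g))); first by rewrite /theta; lra.
  by rewrite ler_wpM2l//; lra.
have U5 : 4 * N * D * ((g + e) / vi) <= 4 * N * D * (18 / 16).
  by rewrite ler_wpM2l// -!mulrA mulr_ge0// ltW.
have U6 : N * (e / vi) <= N * (17 / 16 * theta) by rewrite ler_wpM2l// ltW.
have -> : (Z * g + 4 * N * D * (g + e) + N * e) / vi
    + 2 * N * e * (g + e) / (vi * vk) - (Z / g + a) * w =
  Z * g / vi + 4 * N * D * ((g + e) / vi) + N * (e / vi)
    + 2 * N * e * (g + e) / (vi * vk) - Z / g * w - a * w.
  by field; rewrite !gt_eqF.
lra.
Qed.

(** * Velocities of nearly synchronized states and contraction of the phases *)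

Section Phases.
Context (K : realType) (n : nat) (P R : K -> K) (kappa N c gamma D eps : K)
  (omega : 'I_n -> K).
Hypothesis n_gt0 : (0 < n)%N.
Hypothesis P_deriv : forall x : K, is_derive x 1 P (derive1 P x).
Hypotheses (kappa_gt0 : 0 < kappa) (N_gt0 : 0 < N) (D_gt0 : 0 < D)
  (gamma_ge0 : 0 <= gamma).
(** In the application N = kappa M / 16 and c = kappa / kappa_*; the bounds by N come from products
    of sup norms of derivatives of [P] and [R]. *)
Hypothesis PR_le : forall x y, kappa * (`|P x| * `|R y|) <= N.
Hypothesis dPR_le : forall x y, kappa * (`|derive1 P x| * `|R y|) <= N.
Hypothesis P_lip : forall x y z,
  kappa * (`|P x - P y| * `|R z|) <= N * `|x - y|.
Hypothesis R_lip : forall x y z,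
  kappa * (`|P z| * `|R x - R y|) <= N * `|x - y|.
Hypothesis dP_lip : forall x y z,
  kappa * (`|derive1 P x - derive1 P y| * `|R z|) <= N * `|x - y|.
Hypothesis dPR_lip : forall x y z,
  kappa * (`|derive1 P z| * `|R x - R y|) <= N * `|x - y|.
Hypothesis PR_le_c : forall x, kappa * P x * R x <= c.
Local Notation e := (gamma + 4 * N * D).
Hypothesis e_small : 17 * e <= 1 - c.
Hypothesis c_lt1 : c < 1.
Hypothesis omega_near : forall i, `|omega i - 1| <= gamma.

Definition vel (x : 'I_n -> K) (i : 'I_n) : K :=
  omega i - kappa * avg (fun j => P (x j)) * R (x i).

(** Velocity of the fully synchronized state at [m] with natural frequency 1. *)
Definition speed (m : K) : K := 1 - kappa * P m * R m.

Lemma e_ge0 : 0 <= e.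
Proof. by rewrite addr_ge0// !mulr_ge0// ltW. Qed.

Lemma speed_ge m : 1 - c <= speed m.
Proof. by rewrite /speed lerD2l lerN2. Qed.

Lemma speed_gt0 m : 0 < speed m.
Proof. by rewrite (lt_le_trans _ (speed_ge m))// subr_gt0. Qed.

Lemma speed_le m : speed m <= 1 + N.
Proof.
rewrite /speed lerD2l (le_trans (ler_norm _))// normrN !normrM -mulrA.
by rewrite ger0_norm ?(ltW kappa_gt0)// PR_le.
Qed.

Lemma scale_norm_avg_le (s b : K) (u : 'I_n -> K) : 0 <= s ->
  (forall j, s * `|u j| <= b) -> s * `|avg u| <= b.
Proof.
move=> s0 ub; rewrite -{1}(ger0_norm s0) -normrM avgZ norm_avg_le// => j.
by rewrite normrM ger0_norm.
Qed.

(** The error [e] collects gamma from the frequency, 2 N D from moving the arguments of [P] to [m],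
    and 2 N D from moving that of [R]. *)
Lemma vel_near (x : 'I_n -> K) (m : K) (i : 'I_n) :
  (forall j, `|x j - m| <= 2 * D) -> `|vel x i - speed m| <= e.
Proof.
move=> xm.
pose u j := P (x j) - P m.
have -> : vel x i - speed m = (omega i - 1) - kappa * avg u * R (x i)
    - kappa * P m * (R (x i) - R m).
  have -> : avg u = avg (fun j => P (x j)) - P m.
    by rewrite -{1}[P m](avg_cst n_gt0) avgB.
  by rewrite /vel /speed; ring.
have A1 : `|kappa * avg u * R (x i)| <= N * (2 * D).
  rewrite 2!normrM (ger0_norm (ltW kappa_gt0)) mulrAC.
  apply: scale_norm_avg_le => [|j]; first by rewrite mulr_ge0// ltW.
  rewrite -mulrA [_ * `|u j|]mulrC (le_trans (P_lip _ _ _))//.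
  by rewrite ler_wpM2l// ltW.
have A2 : `|kappa * P m * (R (x i) - R m)| <= N * (2 * D).
  rewrite !normrM (ger0_norm (ltW kappa_gt0)) -mulrA (le_trans (R_lip _ _ _))//.
  by rewrite ler_wpM2l// ltW.
rewrite (le_trans (ler_normB _ _))// (le_trans (lerD (ler_normB _ _) (lexx _)))//.
have := omega_near i; lra.
Qed.

Lemma dist_avg_le (x : 'I_n -> K) : (forall i j, `|x i - x j| <= D) ->
  forall j, `|x j - avg x| <= D.
Proof.
by move=> xD j; rewrite distrC; apply: avg_dist_le.
Qed.

Lemma vel_near_avg (x : 'I_n -> K) i : (forall i j, `|x i - x j| <= D) ->
  `|vel x i - speed (avg x)| <= e.
Proof.
move=> xD; apply: vel_near => j; apply: (le_trans (dist_avg_le xD j)).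
have := D_gt0; lra.
Qed.

Lemma vel_ge (x : 'I_n -> K) i : (forall i j, `|x i - x j| <= D) ->
  16 / 17 * (1 - c) <= vel x i.
Proof.
move=> xD; have := vel_near_avg i xD; rewrite ler_norml => /andP[v1 v2].
have := speed_ge (avg x); have := e_small; lra.
Qed.

Lemma vel_le (x : 'I_n -> K) i : (forall i j, `|x i - x j| <= D) ->
  vel x i <= 2 * (1 + N).
Proof.
move=> xD; have := vel_near_avg i xD; rewrite ler_norml => /andP[v1 v2].
have := speed_le (avg x); have := speed_ge (avg x); have := N_gt0; have := e_ge0; have := e_small.
lra.
Qed.

Context (x : K -> 'I_n -> K).
Hypothesis x_deriv : forall i (t : K),
  is_derive t 1 (fun s => x s i) (vel (x t) i).
(** Slightly negative times are included because y_i(0) may lie behind x_i(0), which makes the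
    initial phase negative. *)
Hypothesis x_close : forall t, - eps < t -> forall i j, `|x t i - x t j| <= D.

Lemma trajectory_increment_ge i (r s : K) : - eps < r -> r <= s ->
  16 / 17 * (1 - c) * (s - r) <= x s i - x r i.
Proof.
move=> r0 rs.
apply: (@increment_ge K (fun t => x t i) (fun t => vel (x t) i)) => //.
move=> t /andP[rt _]; apply: vel_ge; apply: x_close; exact: lt_le_trans rt.
Qed.

Lemma trajectory_nondecreasing i (r s : K) : - eps < r -> r <= s ->
  x r i <= x s i.
Proof.
move=> r0 rs; have := trajectory_increment_ge i r0 rs.
rewrite -[_ <= x s i]subr_ge0; apply: le_trans.
have c1 := c_lt1; rewrite mulr_ge0 ?subr_ge0//; lra.
Qed.

Section Contraction.
Context (y tau : 'I_n -> K).
Hypothesis y_close : forall i j, `|y i - y j| <= D.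
Hypothesis tau_gt : forall i, - eps < tau i.
Hypothesis tauE : forall i, x (tau i) i = y i.

(** One instant is frozen in this section; differentiating x_i(tau_i) = y_i in time shows that this
    is the derivative of tau_i. *)
Let phase_vel i := vel y i / vel (x (tau i)) i.
Let m := avg y.
Let g := speed m.

(** By monotonicity x_j(r) lies between x_j(tau_l) and x_j(tau_u). At time tau_i, x_j is within D of
    x_i(tau_i) = y_i, itself within D of the mean. *)
Lemma between_close (l u : 'I_n) (r : K) (j : 'I_n) :
  tau l <= r <= tau u -> `|x r j - m| <= 2 * D.
Proof.
move=> /andP[lr ru].
have r0 : - eps < r := lt_le_trans (tau_gt l) lr.
have S i : `|x (tau i) j - m| <= 2 * D.
  have -> : x (tau i) j - m = (x (tau i) j - x (tau i) i) + (y i - m).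
    by rewrite tauE; ring.
  rewrite (le_trans (ler_normD _ _))//.
  have := x_close (tau_gt i) j i; have := dist_avg_le y_close i; have := D_gt0; rewrite -/m; lra.
have := S l; have := S u; rewrite !ler_norml => /andP[_ u2] /andP[l1 _].
have := trajectory_nondecreasing j (tau_gt l) lr.
have := trajectory_nondecreasing j r0 ru.
by move=> H1 H2; apply/andP; split; lra.
Qed.

Lemma vel_between (l u : 'I_n) (r : K) (j : 'I_n) :
  tau l <= r <= tau u -> `|vel (x r) j - g| <= e.
Proof. by move=> lru; apply: vel_near => i; exact: between_close lru. Qed.

Lemma vel_tau i : `|vel (x (tau i)) i - g| <= e.
Proof. by apply: (@vel_between i i); rewrite lexx. Qed.

Lemma g_bounds : 0 < g /\ 17 * e <= g.
Proof. by split; [exact: speed_gt0|exact: le_trans e_small (speed_ge _)]. Qed.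

Lemma vel_tau_gt0 i : 0 < vel (x (tau i)) i.
Proof.
have := vel_tau i; rewrite ler_norml => /andP[v1 _].
have [g0 eg] := g_bounds; have := e_ge0; lra.
Qed.

(** Since y_j = x_j(tau_j), this is the mean value theorem for P(x_j) between the times tau_k and
    tau_j, where the speed is at most g + e. The factor [s] will be |R| or an increment of [R]. *)
Lemma coupling_increment (k : 'I_n) (d s B : K) (j : 'I_n) : 0 <= s ->
  (forall z, kappa * (`|derive1 P z| * s) <= B) ->
  (forall j, `|tau j - tau k| <= d) ->
  kappa * s * `|P (y j) - P (x (tau k) j)| <= B * (g + e) * d.
Proof.
move=> s0 sB taud; rewrite -tauE.
have B0 : 0 <= B by rewrite (le_trans _ (sB 0))// !mulr_ge0// ltW.
have key l u : tau l <= tau u ->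
    kappa * s * `|P (x (tau u) j) - P (x (tau l) j)|
    <= B * (g + e) * `|tau u - tau l|.
  move=> lu.
  have [r lru ->] := @is_derive_MVT K (P \o (fun s => x s j))
    (fun s => derive1 P (x s j) * vel (x s) j) _ _ lu
    (fun s _ => is_derive1_comp (P_deriv _) (x_deriv j s)).
  rewrite 2!normrM mulrA ler_wpM2r//.
  have V' : `|vel (x r) j| <= g + e.
    have [g0 eg] := g_bounds; have := e_ge0; have := vel_between j lru.
    by rewrite !ler_norml => /andP[V1 V2] e0; apply/andP; split; lra.
  rewrite mulrA ler_pM// ?mulr_ge0// ?(ltW kappa_gt0)//.
  by rewrite -mulrA [X in _ * X]mulrC.
apply: (@le_trans _ _ (B * (g + e) * `|tau j - tau k|)).
  have [/key//|/ltW/key] := leP (tau k) (tau j).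
  by rewrite distrC [in X in _ <= X]distrC.
have [g0 eg] := g_bounds; have := e_ge0 => e0.
by rewrite ler_wpM2l// mulr_ge0//; lra.
Qed.

(** The velocities of y_i and of x_i at tau_i share omega_i and R(y_i), so they differ only through
    the averages of [P]. *)
Lemma phase_velE i : phase_vel i = 1 -
  kappa * R (y i) / vel (x (tau i)) i
    * avg (fun j => P (y j) - P (x (tau i) j)).
Proof.
rewrite /phase_vel -avgB.
have v0 := vel_tau_gt0 i.
have -> : vel y i = vel (x (tau i)) i
    - kappa * (avg (fun j => P (y j)) - avg (fun j => P (x (tau i) j))) * R (y i).
  by rewrite /vel tauE; ring.
by field; rewrite gt_eqF.
Qed.

(** The coupling difference is at most N (g + e) d, and g + e is at most twice the velocity in the
    denominator. *)
Lemma phase_vel_near (d : K) (l : 'I_n) :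
  (forall j k, `|tau j - tau k| <= d) -> `|phase_vel l - 1| <= 2 * N * d.
Proof.
move=> taud; rewrite phase_velE addrAC subrr add0r normrN.
have v0 := vel_tau_gt0 l.
set b := avg _.
have B : kappa * `|R (y l)| * `|b| <= N * (g + e) * d.
  apply: scale_norm_avg_le => [|j]; first by rewrite mulr_ge0// ltW.
  by apply: coupling_increment => // z; exact: dPR_le.
rewrite 3!normrM normfV (gtr0_norm v0) (gtr0_norm kappa_gt0).
rewrite mulrAC ler_pdivrMr// (le_trans B)//.
have d0 : 0 <= d by rewrite (le_trans _ (taud l l)).
have -> : 2 * N * d * vel (x (tau l)) l = N * (2 * vel (x (tau l)) l) * d by ring.
rewrite ler_wpM2r// ler_wpM2l ?(ltW N_gt0)//.
have := vel_tau l; rewrite ler_norml => /andP[v1 _].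
have [g0 eg] := g_bounds; have := e_ge0; lra.
Qed.

(** For [h] with h' = - h (kappa P' R / g + a), the left-hand side is the time derivative of (tau_i
    - tau_k) h(m) divided by h(m), at an instant when tau_i is the largest phase and tau_k the
    smallest. *)
Lemma phase_contraction (a : K) (i k : 'I_n) :
  16 * N * D + 16 * N * (e / g) <= a * g ->
  (forall j, tau k <= tau j <= tau i) ->
  phase_vel i - phase_vel k
    - (tau i - tau k) * ((kappa * derive1 P m * R m / g + a) * avg (vel y))
  <= - (N * D) * (tau i - tau k).
Proof.
move=> ag tauki.
set d := tau i - tau k.
have ki : tau k <= tau i by case/andP: (tauki i).
have d0 : 0 <= d by rewrite subr_ge0.
have ge0 : 0 <= g + e by have [? _] := g_bounds; have := e_ge0; lra.
have taud j : `|tau j - tau k| <= d.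
  by have /andP[t1 t2] := tauki j; rewrite ger0_norm ?subr_ge0// lerD2r.
have [g0 eg] := g_bounds.
have e0 := e_ge0.
pose vi := vel (x (tau i)) i; pose vk := vel (x (tau k)) k.
have vi0 : 0 < vi := vel_tau_gt0 i.
have vk0 : 0 < vk := vel_tau_gt0 k.
pose Z := kappa * derive1 P m * R m.
have ZN : `|Z| <= N by rewrite !normrM (gtr0_norm kappa_gt0) -mulrA.
have W : `|avg (vel y) - g| <= e.
  apply: avg_dist_le => // j; exact: vel_near_avg.
have rate := contraction_rate N_gt0 D_gt0 g0 e0 eg ZN (vel_tau i) (vel_tau k) W ag.
pose b := avg (fun j => P (y j) - P (x (tau k) j)).
have bN z : kappa * `|R z| * `|b| <= N * (g + e) * d.
  apply: scale_norm_avg_le => [|j]; first by rewrite mulr_ge0// ltW.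
  by apply: coupling_increment => // ?; exact: dPR_le.
have bL (z z' : K) :
    kappa * `|R z - R z'| * `|b| <= N * `|z - z'| * (g + e) * d.
  apply: scale_norm_avg_le => [|j]; first by rewrite mulr_ge0// ltW.
  by apply: coupling_increment => // ?; exact: dPR_lip.
(* The mean value theorem for the averaged coupling between tau_k and tau_i gives a slope [p], so
   that the average belonging to i is b - p d. *)
have [r rki Qr] := @is_derive_MVT K (fun s => avg (fun j => P (x s j)))
  (fun s => avg (fun j => derive1 P (x s j) * vel (x s) j)) _ _ ki
  (fun s _ => is_derive_avg (fun j => is_derive1_comp (P_deriv _) (x_deriv j s))).
pose p := avg (fun j => derive1 P (x r j) * vel (x r) j).
(* Replacing P' and R by their values at m and the velocities by g costs three errors, from
   distances 2 D, D and e. *)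
have pN : kappa * R (y i) * p <= Z * g + 3 * N * D * (g + e) + N * e.
  suff : `|kappa * R (y i) * p - Z * g| <= 3 * N * D * (g + e) + N * e.
    by rewrite ler_norml => /andP[_]; lra.
  rewrite avgZ; apply: avg_dist_le => // j.
  have vjg := vel_between j rki.
  have vj : `|vel (x r) j| <= g + e.
    by move: vjg; rewrite !ler_norml => /andP[V1 V2]; apply/andP; split; lra.
  have -> : kappa * R (y i) * (derive1 P (x r j) * vel (x r) j) - Z * g
     = kappa * ((derive1 P (x r j) - derive1 P m) * R (y i)) * vel (x r) j
       + kappa * (derive1 P m * (R (y i) - R m)) * vel (x r) j
       + Z * (vel (x r) j - g) by rewrite /Z; ring.
  have E1 : `|kappa * ((derive1 P (x r j) - derive1 P m) * R (y i)) * vel (x r) j|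
      <= N * (2 * D) * (g + e).
    rewrite normrM ler_pM// 2!normrM (gtr0_norm kappa_gt0).
    rewrite (le_trans (dP_lip _ _ _))// ler_wpM2l ?(ltW N_gt0)//.
    exact: between_close rki.
  have E2 : `|kappa * (derive1 P m * (R (y i) - R m)) * vel (x r) j|
      <= N * D * (g + e).
    rewrite normrM ler_pM// 2!normrM (gtr0_norm kappa_gt0).
    rewrite (le_trans (dPR_lip _ _ _))// ler_wpM2l ?(ltW N_gt0)//.
    exact: dist_avg_le.
  have E3 : `|Z * (vel (x r) j - g)| <= N * e by rewrite normrM ler_pM.
  rewrite (le_trans (ler_normD _ _))// (le_trans (lerD (ler_normD _ _) (lexx _)))//.
  lra.
(* The first term carries the rate Z. The other two compare R and the velocities of i and k; each
   contains [b], hence a factor d times something small. *)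
have -> : phase_vel i - phase_vel k
  = d * (kappa * R (y i) * p / vi)
    - (kappa * (R (y i) - R (y k)) * b / vi
       + kappa * R (y k) * b * (vk - vi) / (vi * vk)).
  rewrite !phase_velE -/vi -/vk -/b.
  have -> : avg (fun j => P (y j) - P (x (tau i) j)) = b - p * d.
    by rewrite -Qr /b -!avgB; ring.
  by field; rewrite !gt_eqF.
have B1 : d * (kappa * R (y i) * p / vi)
    <= d * ((Z * g + 3 * N * D * (g + e) + N * e) / vi).
  by rewrite ler_wpM2l// ler_wpM2r// invr_ge0 ltW.
have B2 : - (kappa * (R (y i) - R (y k)) * b / vi) <= d * (N * D * (g + e) / vi).
  have -> : d * (N * D * (g + e) / vi) = N * D * (g + e) * d / vi by ring.
  rewrite (le_trans (ler_norm _))// normrN normrM normfV (gtr0_norm vi0).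
  rewrite ler_wpM2r ?invr_ge0 ?(ltW vi0)// 2!normrM (gtr0_norm kappa_gt0).
  rewrite (le_trans (bL _ _))// ler_wpM2r// ler_wpM2r//.
  by rewrite ler_wpM2l ?(ltW N_gt0).
have B3 : - (kappa * R (y k) * b * (vk - vi) / (vi * vk))
    <= d * (2 * N * e * (g + e) / (vi * vk)).
  have -> : d * (2 * N * e * (g + e) / (vi * vk))
     = N * (g + e) * d * (2 * e) / (vi * vk) by ring.
  rewrite (le_trans (ler_norm _))// normrN normrM normfV.
  rewrite (gtr0_norm (mulr_gt0 vi0 vk0)).
  rewrite ler_wpM2r ?invr_ge0 ?mulr_ge0 ?(ltW vi0) ?(ltW vk0)//.
  rewrite normrM ler_pM//; first by rewrite 2!normrM (gtr0_norm kappa_gt0) bN.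
  have := vel_tau i; have := vel_tau k; rewrite -/vi -/vk !ler_norml.
  by move=> /andP[k1 k2] /andP[i1 i2]; apply/andP; split; lra.
have := ler_wpM2l d0 rate; rewrite -/vi -/vk -/Z.
have -> : d * ((Z * g + 4 * N * D * (g + e) + N * e) / vi
      + 2 * N * e * (g + e) / (vi * vk) - (Z / g + a) * avg (vel y))
  = d * ((Z * g + 3 * N * D * (g + e) + N * e) / vi) + d * (N * D * (g + e) / vi)
    + d * (2 * N * e * (g + e) / (vi * vk)) - d * ((Z / g + a) * avg (vel y)).
  by ring.
lra.
Qed.
End Contraction.
End Phases.

(** * Existence of the phases and differentiation of the functional *)

(** [f] is strictly increasing beyond [l], so tau is its inverse there composed with [y]; the
    derivative follows from the inverse function and chain rules. *)
Lemma exists_phase (K : realType) (f df y dy : K -> K) (l : K) :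
  (forall t : K, is_derive t 1 f (df t)) ->
  (forall t : K, l < t -> 0 < df t) ->
  (forall t : K, 0 <= t -> is_derive t 1 y (dy t)) ->
  (forall t : K, 0 <= t -> exists2 r, l < r & f r = y t) ->
  exists tau : K -> K, forall t : K, 0 <= t ->
    [/\ l < tau t, f (tau t) = y t & is_derive t 1 tau (dy t / df (tau t))].
Proof.
move=> fdf df0 ydy ex.
have f_inc r s : l < r -> r < s -> f r < f s.
  move=> lr rs.
  have [z /andP[rz _] fE] := is_derive_MVT (ltW rs) (fun x _ => fdf x).
  rewrite -subr_gt0 fE mulr_gt0 ?subr_gt0// df0//; exact: lt_le_trans rz.
have f_inj r s : l < r -> l < s -> f r = f s -> r = s.
  move=> lr ls fE; have [rs|rs|//] := ltgtP r s.
    by have := f_inc _ _ lr rs; rewrite fE ltxx.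
  by have := f_inc _ _ ls rs; rewrite fE ltxx.
(* A left inverse of [f] beyond [l], by choice of a preimage; 0 is the default off the image. *)
pose g s := if pselect (exists2 r, l < r & f r = s) is left ex
            then projT1 (cid2 ex) else 0.
have gP s : (exists2 r, l < r & f r = s) -> l < g s /\ f (g s) = s.
  by rewrite /g; case: pselect => // ex' _; case: (cid2 ex').
have gK r : l < r -> g (f r) = r.
  move=> lr; have [|lg fg] := gP (f r); first by exists r.
  exact: f_inj.
exists (g \o y) => t t0; have [lg fg] := gP _ (ex t t0).
split => //=.
rewrite mulrC; apply: is_derive1_comp (ydy t t0).
rewrite -{1}fg; apply: is_derive_inverse.
- by near=> r; apply: gK; near: r; exact: lt_nbhsr.
- near=> r; apply/differentiable_continuous/derivable1_diffP.
  by have [] := fdf r.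
- by rewrite gt_eqF// df0.
Unshelve. all: by end_near. Qed.

Lemma is_derive_phase_functional (K : realType) (u v1 v2 H : K -> K)
    (s c1 c2 du dv1 dv2 dH : K) :
  is_derive s 1 u du -> is_derive s 1 v1 dv1 -> is_derive s 1 v2 dv2 ->
  is_derive s 1 H dH ->
  is_derive s 1 (fun s => c1 * (u s - s) + c2 * ((v1 s - v2 s) * H s))
    (c1 * (du - 1) + c2 * (H s * (dv1 - dv2) + (v1 s - v2 s) * dH)).
Proof.
move=> Du D1 D2 DH.
rewrite (_ : (fun _ => _) = c1 *: (u - id) + c2 *: ((v1 - v2) * H)); last exact/funext.
have D0 := is_deriveM (is_deriveB D1 D2) DH.
have D3 := is_deriveZ c2 D0.
have D4 := is_deriveZ c1 (is_deriveB Du (is_derive_id s 1)).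
apply: (is_derive_eq (is_deriveD D4 D3)).
have -> : (v1 - v2) s = v1 s - v2 s by [].
by rewrite /GRing.scale/= [(_ - _) * dH + _]addrC.
Qed.

(** * Stability estimate for two solutions *)

Section Stability.
Context (K : realType) (n : nat) (P R : K -> K) (kappa N c gamma D : K)
  (omega : 'I_n -> K).
Hypothesis n_gt0 : (0 < n)%N.
Hypothesis P_deriv : forall x : K, is_derive x 1 P (derive1 P x).
Hypotheses (kappa_gt0 : 0 < kappa) (N_gt0 : 0 < N) (D_gt0 : 0 < D)
  (gamma_ge0 : 0 <= gamma).
Hypothesis PR_le : forall x y, kappa * (`|P x| * `|R y|) <= N.
Hypothesis dPR_le : forall x y, kappa * (`|derive1 P x| * `|R y|) <= N.
Hypothesis P_lip : forall x y z,
  kappa * (`|P x - P y| * `|R z|) <= N * `|x - y|.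
Hypothesis R_lip : forall x y z,
  kappa * (`|P z| * `|R x - R y|) <= N * `|x - y|.
Hypothesis dP_lip : forall x y z,
  kappa * (`|derive1 P x - derive1 P y| * `|R z|) <= N * `|x - y|.
Hypothesis dPR_lip : forall x y z,
  kappa * (`|derive1 P z| * `|R x - R y|) <= N * `|x - y|.
Hypothesis PR_le_c : forall x, kappa * P x * R x <= c.
Local Notation e := (gamma + 4 * N * D).
Hypothesis e_small : 17 * e <= 1 - c.
Hypothesis c_lt1 : c < 1.
Hypothesis omega_near : forall i, `|omega i - 1| <= gamma.

Local Notation vel := (vel P R kappa omega).
Local Notation speed := (speed P R kappa).

(** In the application h = g / Delta and a = alpha / Delta. *)
Context (h a : K -> K) (hmin hmax : K).
Hypothesis hmin_gt0 : 0 < hmin.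
Hypothesis h_ge : forall s, hmin <= h s.
Hypothesis h_le : forall s, h s <= hmax.
Hypothesis h_deriv : forall s : K, is_derive s 1 h
  (- h s * (kappa * derive1 P s * R s / speed s + a s)).
Hypothesis a_ge : forall s,
  16 * N * D + 16 * N * (e / speed s) <= a s * speed s.

Let vmin := 16 / 17 * (1 - c).
Let vmax := 2 * (1 + N).
(** Chosen so that weight * hmin * N D = 2 N, the constant in the drift bound of
    [phase_vel_near]. *)
Let weight := 2 / (hmin * D).
(** Initial size of the functional per unit of [d0]: phases start within d0 / vmin of 0, so their
    differences are at most twice that. Neither [eps] nor the solutions enter, which makes the final
    constant uniform. *)
Definition phase_bound := (1 + weight * 2 * hmax) / vmin.
Definition stability_constant := vmax * phase_bound.

Let vmin_gt0 : 0 < vmin.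
Proof. by rewrite mulr_gt0// subr_gt0. Qed.

Let weight_gt0 : 0 < weight.
Proof. by rewrite divr_gt0// mulr_gt0. Qed.

Lemma stability_constant_gt0 : 0 < stability_constant.
Proof.
rewrite mulr_gt0//; first by rewrite mulr_gt0// addr_gt0.
rewrite divr_gt0// addr_gt0// mulr_gt0//; first by rewrite !mulr_gt0// ?invr_gt0 ?mulr_gt0.
exact: lt_le_trans hmin_gt0 (le_trans (h_ge 0) (h_le 0)).
Qed.

Context (eps d0 : K) (x y : K -> 'I_n -> K).
(** Moving at speed at least [vmin], x covers the distance [d0] within a time shorter than [eps]. *)
Hypothesis d0_lt : d0 < vmin * eps.
Hypothesis x_deriv : forall i (t : K),
  is_derive t 1 (fun s => x s i) (vel (x t) i).
Hypothesis x_close : forall t, - eps < t -> forall i j, `|x t i - x t j| <= D.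
Hypothesis y_deriv : forall i (t : K),
  is_derive t 1 (fun s => y s i) (vel (y t) i).
Hypothesis y_close : forall t, 0 <= t -> forall i j, `|y t i - y t j| <= D.
Hypothesis init_close : forall i, `|x 0 i - y 0 i| <= d0.

Let x_vel_ge t i : - eps < t -> vmin <= vel (x t) i.
Proof.
move=> te; apply: (vel_ge (D := D) (N := N) (gamma := gamma)) => //.
exact: x_close.
Qed.

Let x_increment_ge i (r s : K) : - eps < r -> r <= s ->
  vmin * (s - r) <= x s i - x r i.
Proof.
by move=> er rs; apply: (trajectory_increment_ge (D := D) (N := N)
  (gamma := gamma) (P := P) (R := R) (kappa := kappa) (omega := omega)
  (eps := eps)).
Qed.

Let d0_ge0 : 0 <= d0.
Proof. exact: le_trans (init_close (Ordinal n_gt0)). Qed.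

Let eps_gt0 : 0 < eps.
Proof. by rewrite -(pmulr_rgt0 _ vmin_gt0) (le_lt_trans d0_ge0). Qed.

Lemma y_reached i t : 0 <= t -> exists2 r, - eps < r & x r i = y t i.
Proof.
move=> t0.
have y0t : y 0 i <= y t i.
  rewrite -subr_ge0; apply: le_trans (_ : vmin * (t - 0) <= _).
    by rewrite subr0 mulr_ge0// ltW.
  apply: (@increment_ge K (fun s => y s i) (fun s => vel (y s) i)) => //.
  move=> s /andP[s0 _]; apply: (vel_ge (D := D) (N := N) (gamma := gamma)) => //.
  exact: y_close.
(* Times at which x_i is certainly below, respectively above, y_i(t); the intermediate value theorem
   applies between them. *)
pose r0 := - (d0 / vmin); pose T := `|y t i - x 0 i| / vmin.
have r00 : r0 <= 0 by rewrite oppr_le0 divr_ge0// ltW.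
have T0 : 0 <= T by rewrite divr_ge0// ltW.
have er0 : - eps < r0 by rewrite ltrN2 ltr_pdivrMr// mulrC.
have xr0 : x r0 i <= y t i.
  have := x_increment_ge i er0 r00.
  rewrite sub0r opprK [vmin * _]mulrC divfK ?gt_eqF// => H1.
  have := init_close i; rewrite ler_norml => /andP[_]; lra.
have xT : y t i <= x T i.
  have := @x_increment_ge i 0 T; rewrite oppr_lt0 subr0 [vmin * _]mulrC.
  rewrite divfK ?gt_eqF// => /(_ eps_gt0 T0); have := ler_norm (y t i - x 0 i); lra.
have [|||r] := @IVT K (fun s => x s i) r0 T (y t i).
- exact: le_trans T0.
- apply: derivable_within_continuous => s _; by have [] := x_deriv i s.
- by rewrite ge_min xr0 le_max xT orbT.
rewrite in_itv/= => /andP[rr0 _] xr; exists r => //; exact: lt_le_trans rr0.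
Qed.

Theorem stability_estimate (t : K) i : 0 <= t ->
  `|x t i - y t i| <= stability_constant * d0.
Proof.
have /choice[tau tauP] : forall i, exists tau : K -> K, forall t : K, 0 <= t ->
    [/\ - eps < tau t, x (tau t) i = y t i
      & is_derive t 1 tau (vel (y t) i / vel (x (tau t)) i)].
  move=> j; apply: (exists_phase (f := fun s => x s j) (df := fun s => vel (x s) j)
     (y := fun s => y s j) (dy := fun s => vel (y s) j)) => //.
  - by move=> s es; apply: lt_le_trans vmin_gt0 (x_vel_ge _ es).
  - by move=> s s0; exact: y_reached.
pose w (s : K) j := vel (y s) j / vel (x (tau j s)) j.
pose m s := avg (y s).
have m_deriv (s : K) : is_derive s 1 m (avg (vel (y s))).
  exact: is_derive_avg (fun j => y_deriv j s).
(* The index encodes a sign, l, j and k; the maximum over all indices is max |tau_l - s| plus the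
   weighted phase width times h(m). *)
pose F (q : bool * 'I_n * ('I_n * 'I_n)) s :=
  (-1) ^+ q.1.1 * (tau q.1.2 s - s)
  + weight * ((tau q.2.1 s - tau q.2.2 s) * h (m s)).
pose dF (q : bool * 'I_n * ('I_n * 'I_n)) s :=
  (-1) ^+ q.1.1 * (w s q.1.2 - 1)
  + weight * (h (m s) * (w s q.2.1 - w s q.2.2
      - (tau q.2.1 s - tau q.2.2 s) *
      ((kappa * derive1 P (m s) * R (m s) / speed (m s) + a (m s)) * avg (vel (y s))))).
have FdF q (s : K) : 0 <= s -> is_derive s 1 (F q) (dF q s).
  move=> s0; case: q => [[b l] [j k]]; rewrite /F /dF /=.
  have [_ _ Dl] := tauP l s s0.
  have [_ _ Dj] := tauP j s s0.
  have [_ _ Dk] := tauP k s s0.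
  have Dh : is_derive s 1 (h \o m) (- h (m s) *
     (kappa * derive1 P (m s) * R (m s) / speed (m s) + a (m s)) * avg (vel (y s))).
    exact: is_derive1_comp.
  have := is_derive_phase_functional ((-1) ^+ b) weight Dl Dj Dk Dh.
  by move/is_derive_eq; apply; rewrite /w /=; ring.
have dF_le0 q (s : K) : 0 < s -> (forall q', F q' s <= F q s) -> dF q s <= 0.
  move=> /ltW s0; case: q => [[b l] [j k]] qmax; rewrite /dF /=.
  have hm0 : 0 < h (m s) by exact: lt_le_trans hmin_gt0 (h_ge _).
  (* Comparing with indices that differ only in j or in k shows that a maximizing index has tau_j
     largest and tau_k smallest. *)
  have taujk i' : tau k s <= tau i' s <= tau j s.
    have := qmax ((b, l), (i', k)); have := qmax ((b, l), (j, i')).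
    rewrite /F /= !lerD2l !(ler_pM2l weight_gt0) !(ler_pM2r hm0); lra.
  set d := tau j s - tau k s.
  have taud i1 i2 : `|tau i1 s - tau i2 s| <= d.
    have /andP[? ?] := taujk i1; have /andP[? ?] := taujk i2.
    by rewrite ler_norml /d; apply/andP; split; lra.
  have d_ge0 : 0 <= d by exact: le_trans (taud j j).
  have near := phase_vel_near n_gt0 P_deriv kappa_gt0 N_gt0 D_gt0 gamma_ge0 dPR_le
    P_lip R_lip PR_le_c e_small c_lt1 omega_near x_deriv x_close (y_close s0)
    (fun i => let: And3 H _ _ := tauP i s s0 in H)
    (fun i => let: And3 _ H _ := tauP i s s0 in H) l taud.
  have contr := phase_contraction n_gt0 P_deriv kappa_gt0 N_gt0 D_gt0 gamma_ge0 dPR_le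
    P_lip R_lip dP_lip dPR_lip PR_le_c e_small c_lt1 omega_near x_deriv x_close (y_close s0)
    (fun i => let: And3 H _ _ := tauP i s s0 in H)
    (fun i => let: And3 _ H _ := tauP i s s0 in H) (a_ge (m s)) taujk.
  set C := (X in X <= _) in contr.
  (* The drift contributes at most 2 N d, and the contraction at most -2 N d by the choice of
     [weight]. *)
  apply: (@le_trans _ _ (2 * N * d + weight * (hmin * (- (N * D) * d)))); last first.
    rewrite /weight.
    suff -> : 2 * N * d + 2 / (hmin * D) * (hmin * (- (N * D) * d)) = 0 by [].
    by field; rewrite !gt_eqF.
  apply: lerD.
    by rewrite (le_trans (ler_norm _))// normrMsign.
  rewrite ler_pM2l//; apply: (@le_trans _ _ (h (m s) * (- (N * D) * d))).
    by rewrite ler_pM2l.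
  by rewrite ler_wnM2r ?h_ge// mulNr oppr_le0 !mulr_ge0// ltW.
(* x_j needs time at most d0 / vmin, forward or backward, to cover the initial gap. *)
have tau0 j : `|tau j 0| <= d0 / vmin.
  have [et xt _] := tauP j 0 (lexx 0).
  rewrite ler_pdivlMr// mulrC; have := init_close j.
  have [t0|/ltW t0] := leP 0 (tau j 0).
    have := @x_increment_ge j 0 (tau j 0); rewrite oppr_lt0 xt subr0.
    move=> /(_ eps_gt0 t0) H; apply: le_trans; rewrite ger0_norm//.
    by rewrite (le_trans H)// distrC ler_norm.
  have H := x_increment_ge j et t0; rewrite xt sub0r in H.
  by apply: le_trans; rewrite ler0_norm// (le_trans H)// ler_norm.
have F0 q : F q 0 <= phase_bound * d0.
  case: q => [[b l] [j k]]; rewrite /F /= subr0.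
  have -> : phase_bound * d0 = d0 / vmin + weight * (2 * (d0 / vmin) * hmax).
    by rewrite /phase_bound; ring.
  apply: lerD; first by rewrite (le_trans (ler_norm _))// normrMsign.
  rewrite ler_pM2l//; apply: (@le_trans _ _ (2 * (d0 / vmin) * h (m 0))).
    rewrite ler_pM2r; last exact: lt_le_trans hmin_gt0 (h_ge _).
    have := tau0 j; have := tau0 k; rewrite !ler_norml.
    by move=> /andP[? ?] /andP[? ?]; lra.
  by rewrite ler_wpM2l// mulr_ge0// divr_ge0// ltW.
move=> t0; have Fle := max_principle FdF dF_le0 F0.
have taut : `|tau i t - t| <= phase_bound * d0.
  (* With j = k the width term vanishes, and the two signs bound the absolute value. *)
  have := Fle ((true, i), (i, i)) t t0; have := Fle ((false, i), (i, i)) t t0.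
  rewrite /F /= subrr mul0r mulr0 !addr0 expr0 expr1 mul1r mulN1r ler_norml.
  by move=> H1 H2; apply/andP; split; lra.
have [et xt _] := tauP i t t0.
have et' : - eps < t by rewrite (lt_le_trans _ t0)// oppr_lt0.
have key (r s : K) : - eps < r -> - eps < s -> r <= s ->
    `|x s i - x r i| <= vmax * `|s - r|.
  move=> er es rs.
  have [z /andP[rz _] ->] := @is_derive_MVT K (fun s => x s i)
    (fun s => vel (x s) i) _ _ rs (fun s _ => x_deriv i s).
  have ez := lt_le_trans er rz.
  rewrite normrM ler_wpM2r// ger0_norm.
    apply: (vel_le (D := D) (gamma := gamma) (c := c)) => //; exact: x_close.
  exact: le_trans (ltW vmin_gt0) (x_vel_ge _ ez).
rewrite -xt /stability_constant -mulrA.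
apply: (@le_trans _ _ (vmax * `|tau i t - t|)); last first.
  by rewrite ler_wpM2l// mulr_ge0// addr_ge0// ltW.
have [/(key _ _ et et')|/ltW/(key _ _ et' et)] := leP (tau i t) t.
  by rewrite [X in _ <= _ * X]distrC.
by rewrite distrC.
Qed.
End Stability.

(** * Constants *)

Lemma C2_deriv (K : realType) (f : K -> K) : C2 f ->
  [/\ forall x : K, is_derive x 1 f (derive1 f x),
      forall x : K, is_derive x 1 (derive1 f) (derive1n 2 f x),
      continuous f, continuous (derive1 f) & continuous (derive1n 2 f)].
Proof.
move=> [df ddf c2].
have dfE (x : K) : is_derive x 1 f (derive1 f x).
  by rewrite derive1E; exact: derivableP (df x).
have ddfE (x : K) : is_derive x 1 (derive1 f) (derive1n 2 f x).
  by rewrite /derive1n/= [X in is_derive _ _ _ X]derive1E; exact: derivableP (ddf x).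
split.
- exact: dfE.
- exact: ddfE.
- by move=> x; apply/differentiable_continuous/derivable1_diffP; exact: df.
- by move=> x; apply/differentiable_continuous/derivable1_diffP; exact: ddf.
- exact: c2.
Qed.

Lemma pi2_gt0 (K : realType) : 0 < 2 * pi :> K.
Proof. by rewrite mulr_gt0// pi_gt0. Qed.

Lemma C2_periodic_sup_norm (K : realType) (f : K -> K) : C2 f ->
  periodic f (2 * pi) -> forall (i : 'I_3) (x : K), `|derive1n i f x| <= sup_norm (derive1n i f).
Proof.
move=> f2 fT; have [df ddf c0 c1 c2] := C2_deriv f2.
have fT1 : periodic (derive1 f) (2 * pi).
  by apply: periodic_derive1 fT => x; have [] := df x.
have fT2 : periodic (derive1n 2 f) (2 * pi).
  by apply: periodic_derive1 fT1 => x; have [] := ddf x.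
case => -[|[|[|i]]] i3 x.
- exact: periodic_sup_norm (pi2_gt0 K) c0 fT x.
- exact: periodic_sup_norm (pi2_gt0 K) c1 fT1 x.
- exact: periodic_sup_norm (pi2_gt0 K) c2 fT2 x.
- by [].
Qed.

Lemma Mconst_ge (K : realType) (P R : K -> K) (i j : 'I_3) :
  sup_norm (derive1n i P) * sup_norm (derive1n j R) <= Mconst P R / 16.
Proof.
rewrite /Mconst mulrAC divff ?mul1r// ?pnatr_eq0//.
apply: le_trans (le_bigmax _ _ i); exact: (le_bigmax _ _ j).
Qed.

Lemma C2_lipschitz (K : realType) (f : K -> K) : C2 f -> periodic f (2 * pi) ->
  forall (i : 'I_2) (x y : K), `|derive1n i f x - derive1n i f y|
    <= sup_norm (derive1n i.+1 f) * `|x - y|.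
Proof.
move=> f2 fT i x y; have [df ddf _ _ _] := C2_deriv f2.
have B := C2_periodic_sup_norm f2 fT.
apply: (lipschitz_of_deriv_le (df := derive1n i.+1 f)).
  by case: i => -[|[|i]] i2 z; [exact: df|exact: ddf|].
have i3 : (i.+1 < 3)%N by case: i => -[|[|]].
exact: (B (Ordinal i3)).
Qed.

Section SupNormProducts.
Context (K : realType) (P R : K -> K).
Hypotheses (P_C2 : C2 P) (R_C2 : C2 R)
  (P_periodic : periodic P (2 * pi)) (R_periodic : periodic R (2 * pi)).
Hypothesis sup_PR_gt0 : 0 < sup (range (fun x => P x * R x)).
Let M := Mconst P R.

Lemma norm_mul_le (i j : 'I_3) (x y : K) :
  `|derive1n i P x| * `|derive1n j R y| <= M / 16.
Proof.
apply: le_trans (Mconst_ge P R i j).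
by rewrite ler_pM// C2_periodic_sup_norm.
Qed.

Lemma norm_mul_incrementl_le (i : 'I_2) (x y z : K) :
  `|derive1n i P x - derive1n i P y| * `|R z| <= M / 16 * `|x - y|.
Proof.
have i3 : (i.+1 < 3)%N by case: i => -[|[|]].
apply: (@le_trans _ _ (sup_norm (derive1n i.+1 P) * `|x - y| * sup_norm (derive1n 0 R))).
  rewrite ler_pM//; first exact: C2_lipschitz.
  exact: (C2_periodic_sup_norm R_C2 R_periodic (@Ordinal 3 0 isT)).
rewrite mulrAC ler_wpM2r//; exact: (Mconst_ge P R (Ordinal i3) (@Ordinal 3 0 isT)).
Qed.

Lemma norm_mul_incrementr_le (i : 'I_3) (x y z : K) :
  `|derive1n i P z| * `|R x - R y| <= M / 16 * `|x - y|.
Proof.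
apply: (@le_trans _ _ (sup_norm (derive1n i P) * (sup_norm (derive1n 1 R) * `|x - y|))).
  rewrite ler_pM//; first exact: C2_periodic_sup_norm.
  exact: (C2_lipschitz R_C2 R_periodic (@Ordinal 2 0 isT)).
by rewrite mulrA ler_wpM2r//; exact: (Mconst_ge P R i (@Ordinal 3 1 isT)).
Qed.

Lemma mul_le_sup (x : K) : P x * R x <= sup (range (fun x => P x * R x)).
Proof.
apply: ub_le_sup; last by exists x.
exists (M / 16) => _ [z _ <-]; apply: le_trans (ler_norm _) _.
by rewrite normrM; exact: (norm_mul_le (@Ordinal 3 0 isT) (@Ordinal 3 0 isT)).
Qed.

(** A positive supremum yields a point where P R > 0, and this value is at most M / 16. *)
Lemma Mconst_gt0 : 0 < M.
Proof.
have [] := @sup_gt _ (range (fun x => P x * R x)) 0 => //.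
  by exists (P 0 * R 0); exists 0.
move=> _ [z _ <-] PR0; rewrite -(pmulr_lgt0 M (_ : 0 < 16^-1))//.
apply: lt_le_trans PR0 (le_trans (ler_norm _) _).
by rewrite normrM; exact: (norm_mul_le (@Ordinal 3 0 isT) (@Ordinal 3 0 isT)).
Qed.
End SupNormProducts.

(* Evaluate the equation at a critical point of Delta, given by Rolle's theorem. *)
Lemma alpha_le (K : realType) (P R Delta : K -> K) (kappa N c D al : K) :
  0 < kappa -> 0 < N -> 0 < D -> c < 1 ->
  (forall x, kappa * P x * R x <= c) ->
  (forall x y, kappa * (`|P x| * `|derive1 R y|) <= N) ->
  (forall s : K, derivable Delta s 1) -> periodic Delta (2 * pi) ->
  (forall s, 0 < Delta s < D) ->
  (forall s, derive1 Delta s =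
     - (kappa * P s * derive1 R s / (1 - kappa * P s * R s)) * Delta s + al) ->
  al <= N * D / (1 - c).
Proof.
move=> k0 N0 D0 c1 PRc PdR dD DT Dlt DE.
have [||s _ sD] := Rolle (pi2_gt0 K) (fun x _ => dD x).
- by apply: derivable_within_continuous => x _.
- by rewrite -(DT 0) add0r.
have /andP[Ds0 DsD] := Dlt s.
have q0 : 0 < 1 - c by rewrite subr_gt0.
have qg : 1 - c <= 1 - kappa * P s * R s by rewrite lerD2l lerN2.
have g0 := lt_le_trans q0 qg.
have : derive1 Delta s = 0 by rewrite derive1E (@derive_val _ _ _ _ _ _ _ sD).
rewrite DE => /eqP; rewrite addrC addr_eq0 mulNr opprK => /eqP ->.
apply: le_trans (ler_norm _) _.
rewrite normrM (gtr0_norm Ds0) [N * D / _]mulrAC ler_pM ?(ltW Ds0) ?(ltW DsD)//.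
rewrite normrM normfV (gtr0_norm g0) ler_pM ?invr_ge0 ?(ltW g0)//.
  by rewrite !normrM (gtr0_norm k0) -mulrA.
by rewrite lef_pV2.
Qed.

(** Here q = 1 - kappa / kappa_* and M kappa = 16 N. The formula for alpha bounds it from below, and
    the critical point of Delta bounds it from above; together they force gamma and N D to be
    small. *)
Lemma alpha_smallness (K : realType) (N D gamma q g al Ds : K) :
  0 < N -> 0 < gamma -> 0 < D -> 0 < Ds < D -> 0 < q <= g ->
  0 < q - gamma - 16 * N * D ->
  al = (2 * gamma + 16 * N * D ^+ 2) / q
    + (2 * gamma + 16 * N * D ^+ 2 + 16 * N * D) * (gamma + 16 * N * D)
       / ((q - gamma - 16 * N * D) * q) ->
  al <= N * D / q ->
  17 * (gamma + 4 * N * D) <= q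
  /\ 16 * N * D + 16 * N * ((gamma + 4 * N * D) / g) <= al / Ds * g.
Proof.
move=> N0 gam0 D0 /andP[Ds0 DsD] /andP[q0 qg] q00 alE alle.
have g0 : 0 < g by exact: lt_le_trans qg.
have ND0 : 0 < N * D by rewrite mulr_gt0.
set E := gamma + 16 * N * D.
have E0 : 0 < E by rewrite /E; lra.
set r := q - gamma - 16 * N * D in alE q00.
have al_ge : D * (16 * N * D / q + 16 * N * E / (r * q)) <= al.
  rewrite alE -/E -subr_ge0.
  rewrite (_ : _ - _ = 2 * gamma / q + (2 * gamma + 16 * N * D ^+ 2) * E / (r * q)).
    rewrite addr_ge0// divr_ge0 ?mulr_ge0 ?(ltW q0) ?(ltW E0) ?(ltW q00)//;
      try lra.
    by rewrite addr_ge0 ?mulr_ge0 ?exprn_ge0//; lra.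
  by field; rewrite !gt_eqF.
(* Keeping only the second term of the lower bound and dividing by N D / q leaves 16 E / r <= 1. *)
have Er : 16 * E <= r.
  have : D * (16 * N * E / (r * q)) <= N * D / q.
    apply: le_trans alle; apply: le_trans al_ge.
    rewrite ler_pM2l// lerDr divr_ge0 ?(ltW q0)//; lra.
  have -> : D * (16 * N * E / (r * q)) = (N * D / q) * (16 * E / r).
    by field; rewrite !gt_eqF.
  by rewrite ger_pMr ?divr_gt0// ler_pdivrMr// mul1r.
have eE : gamma + 4 * N * D <= E by rewrite /E; lra.
split; first by move: Er eE; rewrite /r /E; lra.
(* The lower bound for alpha carries a factor D, and Ds < D. *)
have a_ge : 16 * N * D / q + 16 * N * E / (r * q) <= al / Ds.
  rewrite ler_pdivlMr//; apply: le_trans al_ge.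
  rewrite mulrC ler_wpM2r ?(ltW DsD)//.
  by rewrite addr_ge0// divr_ge0 ?mulr_ge0 ?(ltW q0) ?(ltW q00) ?(ltW E0)//; lra.
apply: (@le_trans _ _ ((16 * N * D / q + 16 * N * E / (r * q)) * g)); last first.
  by rewrite ler_pM2r.
have -> : (16 * N * D / q + 16 * N * E / (r * q)) * g
   = 16 * N * D * (g / q) + 16 * N * (E / r * (g / q)) by field; rewrite !gt_eqF.
have gq : 1 <= g / q by rewrite ler_pdivlMr// mul1r.
apply: lerD.
  by rewrite ler_peMr//; lra.
rewrite ler_wpM2l//; first lra.
apply: (@le_trans _ _ (E / r)); last first.
  by rewrite ler_peMr// divr_ge0 ?(ltW E0) ?(ltW q00).
rewrite ler_pM ?invr_ge0 ?(ltW g0)//; first lra.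
rewrite lef_pV2 ?posrE//; apply: le_trans qg.
by move: E0; rewrite /r /E; lra.
Qed.

(** * Passage from the flow to coordinates, and conclusion *)

(** Strict inequalities between finitely many continuous functions persist near time 0. This
    supplies the negative times on which x is still close; the resulting [eps] depends on x. *)
Lemma close_near0 (K : realType) (n : nat) (x : K -> 'I_n -> K) (D : K) :
  (forall i, {for 0, continuous (fun t => x t i)}) ->
  (forall i j, `|x 0 i - x 0 j| < D) ->
  exists2 eps : K, 0 < eps &
    forall t : K, `|t| < eps -> forall i j, `|x t i - x t j| <= D.
Proof.
move=> cx x0.
have x_near (ij : 'I_n * 'I_n) : \forall t \near (0 : K), `|x t ij.1 - x t ij.2| < D.
  case: ij => i j /=.
  have cij : `|x t i - x t j| @[t --> (0 : K)] --> `|x 0 i - x 0 j|.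
    by apply: cvg_norm; apply: cvgB; exact: cx.
  by move/cvgr_lt: cij; apply.
have := filter_forall (nbhs_filter (0 : K)) x_near.
move=> /nbhs_ballP[eps eps0 near0]; exists eps => // t teps i j.
by apply/ltW; apply: (near0 t _ (i, j)); rewrite /ball/= sub0r normrN.
Qed.

Lemma coord_le_norm (K : realType) (n : nat) (x : 'rV[K]_n) (i : 'I_n) :
  `|x 0 i| <= `|x|.
Proof.
rewrite [leRHS]/Num.Def.normr/= mx_normrE.
exact: (le_bigmax _ (fun ij => `|x ij.1 ij.2|) (0, i)).
Qed.

Lemma norm_le_coord (K : realType) (n : nat) (x : 'rV[K]_n) (b : K) : 0 <= b ->
  (forall i, `|x 0 i| <= b) -> `|x| <= b.
Proof.
move=> b0 xb; rewrite [leLHS]/Num.Def.normr/= mx_normrE.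
by apply: bigmax_le => // -[i j] _ /=; rewrite (ord1 i).
Qed.

Lemma sync_set_close (K : realType) (n : nat) (Delta : K -> K) (D : K)
    (x : 'rV[K]_n) : (forall s, 0 < Delta s < D) -> sync_set n Delta x ->
  forall i j, `|x 0 i - x 0 j| < D.
Proof.
move=> DltD /bigmax_ltP[_ /= H] i j; have /andP[_ DD] := DltD (mean x).
apply: lt_trans DD; have /bigmax_ltP[_ /= H'] := H j isT; exact: H'.
Qed.

Lemma is_derive_coord (K : realType) (n : nat) (P R : K -> K) (kappa : K)
    (omega : 'I_n -> K) (Phi : K -> 'rV[K]_n -> 'rV[K]_n) (x : 'rV[K]_n) :
  is_flow (winfree P R kappa omega) Phi ->
  forall i (t : K), is_derive t 1 (fun s => Phi s x 0 i)
    (vel P R kappa omega (fun j => Phi t x 0 j) i).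
Proof.
move=> flow i t; have [_ /(_ t) [dPhi PhiE]] := flow x.
apply: DeriveDef; first by have /derivable_mxP := dPhi; apply.
by move: PhiE; rewrite derive_mx// => /rowP /(_ i); rewrite !mxE.
Qed.

(** The equation for Delta is designed for this: the term kappa P R' from g' cancels the one from
    Delta', and only P' R and alpha remain. *)
Lemma is_derive_lyapunov_weight (K : realType) (P R Delta : K -> K)
    (kappa al s : K) :
  is_derive s 1 P (derive1 P s) -> is_derive s 1 R (derive1 R s) ->
  derivable Delta s 1 -> Delta s != 0 -> speed P R kappa s != 0 ->
  derive1 Delta s = - (kappa * P s * derive1 R s / speed P R kappa s) * Delta s + al ->
  let h z := speed P R kappa z * (Delta z)^-1 in
  is_derive s 1 h
   (- h s * (kappa * derive1 P s * R s / speed P R kappa s + al / Delta s)).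
Proof.
move=> dP dR dD D0 g0 DE h.
have dDE : is_derive s 1 Delta (derive1 Delta s).
  by rewrite derive1E; exact: derivableP.
have D1 := is_deriveV D0 dDE.
have D2 := is_deriveZ kappa (is_deriveM dP dR).
have D3 := is_deriveB (is_derive_cst (1 : K) s 1) D2.
have hE : (cst 1 - kappa *: (P * R)) * (fun z => (Delta z)^-1) = h.
  by apply/funext => z; rewrite /h /speed -mulrA.
have D4 := is_deriveM D3 D1; rewrite hE in D4; apply: (is_derive_eq D4).
have -> : (cst 1 - kappa *: (P * R)) s = speed P R kappa s by rewrite /speed -mulrA.
rewrite DE /h /GRing.scale/=; field.
by rewrite D0 g0.
Qed.

Theorem mainTheorem1 (K : realType) (P R : K -> K)
  (P_C2 : C2 P) (R_C2 : C2 R)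
  (P_periodic : periodic P (2 * pi)) (R_periodic : periodic R (2 * pi))
  (sup_PR_gt0 : 0 < sup (range (fun x => P x * R x)))
  (integral_gt0 : forall kappa : K, 0 < kappa < kappa_star P R ->
     0 < \int[lebesgue_measure]_(s in `[0, 2 * pi])
           (P s * derive1 R s / (1 - kappa * P s * R s)))
  (U : set (K * K)) (U_region : sync_region P R U)
  (D : nat -> K -> K -> K) (Delta : nat -> K -> K -> K -> K)
  (D_Delta_data : forall (n : nat) (gamma kappa : K), (0 < n)%N -> U (gamma, kappa) ->
     sync_data P R gamma kappa n (D n gamma kappa) (Delta n gamma kappa)) :
  forall gamma kappa : K, U (gamma, kappa) ->
  forall n : nat, (0 < n)%N ->
  forall omega : 'I_n -> K, (forall i, 1 - gamma < omega i < 1 + gamma) ->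
  forall Phi : K -> 'rV[K]_n -> 'rV[K]_n,
    is_flow (winfree P R kappa omega) Phi ->
    positively_stable Phi (sync_set n (Delta n gamma kappa)).

Proof.
move=> gamma kappa Ugk n n_gt0 omega omegaP Phi flow.
have [_ /(_ _ _ Ugk)[/andP[gamma_gt0 _] /andP[kappa_gt0 _] _] _] := U_region.
have [] := D_Delta_data n gamma kappa n_gt0 Ugk.
set DD := D n gamma kappa; set Dl := Delta n gamma kappa.
move=> [/andP[D0 _] gap] [Dl_C2 Dl_per Dl_bd Dl_eq] inv.
have Pinv := inv omega Phi omegaP flow.
split; first exact: Pinv.
have M0 := Mconst_gt0 P_C2 R_C2 P_periodic R_periodic sup_PR_gt0.
set c := kappa / kappa_star P R in gap.
(* The factor 16 in M is split off here, so that M kappa D becomes 16 N D and leaves room for the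
   numerical factors of the error terms. *)
set N := kappa * (Mconst P R / 16).
have N0 : 0 < N by rewrite mulr_gt0// divr_gt0.
have MkD : Mconst P R * kappa * DD = 16 * N * DD by rewrite /N; field.
have MkD2 : Mconst P R * kappa * DD ^+ 2 = 16 * N * DD ^+ 2 by rewrite /N; field.
have PRc z : kappa * P z * R z <= c.
  rewrite /c /kappa_star invrK -mulrA ler_pM2l//.
  exact: (mul_le_sup P_C2 R_C2 P_periodic R_periodic).
have kN : forall u v w : K, u * v <= Mconst P R / 16 * w -> kappa * (u * v) <= N * w.
  by move=> u v w uv; rewrite /N -[kappa * _ * w]mulrA ler_pM2l.
have NM (i j : 'I_3) (u v : K) :
    kappa * (`|derive1n i P u| * `|derive1n j R v|) <= N.
  by rewrite /N ler_pM2l//; exact: (norm_mul_le P_C2 R_C2 P_periodic R_periodic).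
pose i0 : 'I_3 := @Ordinal 3 0 isT; pose i1 : 'I_3 := @Ordinal 3 1 isT.
pose k0 : 'I_2 := @Ordinal 2 0 isT; pose k1 : 'I_2 := @Ordinal 2 1 isT.
have [dP _ _ _ _] := C2_deriv P_C2.
have [dR _ _ _ _] := C2_deriv R_C2.
have [dDl _ cDl _ _] := C2_deriv Dl_C2.
have Dl_der (s : K) : derivable Dl s 1 by have [] := dDl s.
have c1 : c < 1.
  have : 0 < 16 * N * DD by rewrite mulr_gt0 ?(pmulr_rgt0 _ (ltr0Sn K 15)).
  by move: gap; rewrite MkD => gap; lra.
have al_le := alpha_le kappa_gt0 N0 D0 c1 PRc (NM i0 i1) Dl_der Dl_per Dl_bd Dl_eq.
have q_bounds s : 0 < 1 - c <= speed P R kappa s.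
  by rewrite subr_gt0 c1 (speed_ge PRc).
have small s : 17 * (gamma + 4 * N * DD) <= 1 - c
  /\ 16 * N * DD + 16 * N * ((gamma + 4 * N * DD) / speed P R kappa s)
     <= alpha P R gamma kappa DD / Dl s * speed P R kappa s.
  apply: (alpha_smallness N0 gamma_gt0 D0 (Dl_bd s) (q_bounds s) _ _ al_le).
    by move: gap; rewrite MkD; lra.
  rewrite /alpha MkD MkD2 -/c; congr (_ + _ / (_ * _)); ring.
have [s0 Dl_min] := periodic_min (pi2_gt0 K) cDl Dl_per.
have Dl0 s : 0 < Dl s by case/andP: (Dl_bd s).
(* The bounds on h below use 1 - c <= g <= 1 + N, Delta < D and the positive minimum of Delta over a
   period. *)
have omega_near i : `|omega i - 1| <= gamma.
  by have /andP[? ?] := omegaP i; rewrite ler_norml; apply/andP; split; lra.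
pose h z := speed P R kappa z * (Dl z)^-1.
pose hmin := (1 - c) / DD; pose hmax := (1 + N) / Dl s0.
have hmin0 : 0 < hmin by rewrite divr_gt0// subr_gt0.
have h_ge s : hmin <= h s.
  have /andP[q0 qg] := q_bounds s; have /andP[_ DlD] := Dl_bd s.
  by rewrite ler_pM ?(ltW q0) ?invr_ge0 ?(ltW D0)// lef_pV2 ?posrE// ltW.
have h_le s : h s <= hmax.
  have g0 := speed_gt0 PRc c1 s.
  rewrite ler_pM ?(ltW g0) ?invr_ge0 ?(ltW (Dl0 s))//.
    exact: speed_le kappa_gt0 (NM i0 i0) s.
  by rewrite lef_pV2 ?posrE.
have h_deriv (s : K) := is_derive_lyapunov_weight (dP s) (dR s) (Dl_der s)
  (lt0r_neq0 (Dl0 s)) (lt0r_neq0 (speed_gt0 PRc c1 s)) (Dl_eq s).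
have P_lip u v w := kN _ _ _
  (norm_mul_incrementl_le P_C2 R_C2 P_periodic R_periodic k0 u v w).
have dP_lip u v w := kN _ _ _
  (norm_mul_incrementl_le P_C2 R_C2 P_periodic R_periodic k1 u v w).
have R_lip u v w := kN _ _ _
  (norm_mul_incrementr_le P_C2 R_C2 P_periodic R_periodic i0 u v w).
have dPR_lip u v w := kN _ _ _
  (norm_mul_incrementr_le P_C2 R_C2 P_periodic R_periodic i1 u v w).
pose lambda := stability_constant N c DD hmin hmax.
have lambda0 : 0 < lambda by exact: (stability_constant_gt0 N0 D0 c1 hmin0 h_ge h_le).
exists lambda => // x Cx.
have close z t i j : sync_set n Dl z -> 0 <= t ->
    `|Phi t z 0 i - Phi t z 0 j| <= DD.
  move=> Cz t0; apply/ltW; apply: (sync_set_close Dl_bd).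
  by apply: (Pinv t t0); exists z.
have x0 : Phi 0 x = x by have [] := flow x.
have [eps eps0 near0] : exists2 eps : K, 0 < eps &
    forall t : K, `|t| < eps -> forall i j, `|Phi t x 0 i - Phi t x 0 j| <= DD.
  apply: (@close_near0 K n (fun t i => Phi t x 0 i)) => [i|i j].
    apply/differentiable_continuous/derivable1_diffP.
    by have [] := is_derive_coord x flow i 0.
  by rewrite x0; exact: sync_set_close Dl_bd Cx i j.
have vmin0 : 0 < 16 / 17 * (1 - c) by rewrite mulr_gt0// subr_gt0.
(* This radius is the hypothesis on [d0] in the stability estimate, applied with d0 = |x - y|. *)
exists (16 / 17 * (1 - c) * eps); first by rewrite mulr_gt0.
move=> y Cy xy t t0.
apply: norm_le_coord => [|i]; first by rewrite mulr_ge0// ltW.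
have y0 : Phi 0 y = y by have [] := flow y.
have := @stability_estimate K n P R kappa N c gamma DD omega n_gt0 dP kappa_gt0
  N0 D0 (ltW gamma_gt0) (NM i0 i0) (NM i1 i0) P_lip R_lip dP_lip dPR_lip PRc
  (small 0).1 c1 omega_near h (fun s => alpha P R gamma kappa DD / Dl s)
  hmin hmax hmin0 h_ge h_le h_deriv (fun s => (small s).2) eps `|x - y|
  (fun t i => Phi t x 0 i) (fun t i => Phi t y 0 i) xy (is_derive_coord x flow).
rewrite !mxE; apply => //.
(* Invariance of the set covers nonnegative times, continuity at 0 the negative ones. *)
- move=> s es k l; have [s_ge0|s_lt0] := leP 0 s; first exact: close.
  by apply: near0; rewrite ltr0_norm// ltrNl.
- exact: is_derive_coord.
- by move=> s s_ge0 k l; exact: close.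
- by move=> k; rewrite x0 y0; have := coord_le_norm (x - y) k; rewrite !mxE.
Qed.
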